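(* Let $(P,\mathcal{L},\to,D)$ be a boolean LTS, let $\mathbb{V}$ be the two-state boolean metric LTS over $\mathcal{L}$, and let $\delta:P\times P\to\{\bot_{\mathbb V},\top_{\mathbb V}\}$ be the contextual bisimilarity map. Then $\delta$ is the characteristic function of strong bisimilarity $\sim$: for all $p,q\in P$, $\delta(p,q)=\bot_{\mathbb V}$ if and only if $p\sim q$.
   Context: The boolean quantale $\mathbb{B}$ is the two-element lattice $\{\bot,\top\}$, $\bot<\top$, with $+$ the binary join. Boolean LTS: a labelled transition system $(P,\mathcal{L},\to)$, $\to\subseteq P\times\mathcal{L}\times P$, equipped with the canonical immediate distance $D:P\times P\to\mathbb{B}$: $D(p,q)=\bot$ if for every $\ell\in\mathcal{L}$, $p$ has an outgoing $\ell$-transition iff $q$ does; $D(p,q)=\top$ otherwise. Two-state boolean metric LTS: $\mathbb{V}=(\{\bot_{\mathbb V},\top_{\mathbb V}\},\mathcal{L},\to,\Downarrow)$, whose transitions are exactly $\bot_{\mathbb V}\xrightarrow{\ell}\bot_{\mathbb V}$ for every $\ell\in\mathcal{L}$, with $\Downarrow\bot_{\mathbb V}=\bot$, $\Downarrow\top_{\mathbb V}=\top$; its order is $\bot_{\mathbb V}<_{\mathbb V}\top_{\mathbb V}$ and $\bigwedge_{\mathbb V}$ is the meet of this two-element lattice. Contextual bisimulation map: $m:P\times P\to\{\bot_{\mathbb V},\top_{\mathbb V}\}$ such that for all $p,q$: (1) $D(p,q)\le\Downarrow m(p,q)$; (2) if $m(p,q)\xrightarrow{\ell}s'$ then (a)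 $p\xrightarrow{\ell}p'$ implies there is $q'$ with $q\xrightarrow{\ell}q'$ and $m(p',q')\le_{\mathbb V}s'$; (b) $q\xrightarrow{\ell}q'$ implies there is $p'$ with $p\xrightarrow{\ell}p'$ and $m(p',q')\le_{\mathbb V}s'$. Contextual bisimilarity map: $\delta(p,q)=\bigwedge_{\mathbb V}\{m(p,q)\mid m\text{ is a contextual bisimulation map}\}$. Strong bisimilarity $\sim$ is the largest relation $\mathcal{R}\subseteq P\times P$ such that $p\,\mathcal{R}\,q$ implies: $p\xrightarrow{\ell}p'$ implies there is $q'$ with $q\xrightarrow{\ell}q'$, $p'\,\mathcal{R}\,q'$; and $q\xrightarrow{\ell}q'$ implies there is $p'$ with $p\xrightarrow{\ell}p'$, $p'\,\mathcal{R}\,q'$. *)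

(* Defs.v *)
From HB Require Import structures.
From mathcomp Require Import all_boot all_order.
From mathcomp Require Import boolp classical_sets.

Set Implicit Arguments.
Unset Strict Implicit.
Unset Printing Implicit Defensive.

Import Order.TTheory.
Local Open Scope order_scope.
Local Open Scope classical_set_scope.

(* The boolean quantale is [bool] with the library order: \bot = false,
   \top = true, and the quantale sum is the binary join. *)

(* A labelled transition system with states P and labels L is given by its
   transition relation [tr : P -> L -> P -> Prop]; P and L are arbitrary. *)

Definition can_step (P L : Type) (tr : P -> L -> P -> Prop) (p : P) (l : L)
  : Prop := exists p', tr p l p'.

Definition imm_dist (P L : Type) (tr : P -> L -> P -> Prop) (p q : P) : bool :=
  if `[< forall l : L, can_step tr p l <-> can_step tr q l >]
  then \bot else \top.

Inductive vstate : Type := vbot | vtop.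

Definition bool_of_vstate (s : vstate) : bool :=
  match s with vbot => false | vtop => true end.
Definition vstate_of_bool (b : bool) : vstate := if b then vtop else vbot.

Lemma bool_of_vstateK : cancel bool_of_vstate vstate_of_bool.
Proof. by case. Qed.

HB.instance Definition _ := Countable.copy vstate (can_type bool_of_vstateK).

Definition vle (s t : vstate) : bool :=
  match s, t with vtop, vbot => false | _, _ => true end.

Fact vle_refl : reflexive vle. Proof. by case. Qed.
Fact vle_anti : antisymmetric vle. Proof. by do 2!case. Qed.
Fact vle_trans : transitive vle. Proof. by do 3!case. Qed.
Fact vle_total : total vle. Proof. by do 2!case. Qed.

Fact vstate_display : Order.disp_t. Proof. exact: Order.Disp tt tt. Qed.

HB.instance Definition _ :=
  Order.Le_isPOrder.Build vstate_display vstate vle_refl vle_anti vle_trans.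
HB.instance Definition _ :=
  Order.POrder_isTotal.Build vstate_display vstate vle_total.

Definition vtrans (L : Type) (s : vstate) (l : L) (s' : vstate) : Prop :=
  s = vbot /\ s' = vbot.

Definition vdown (s : vstate) : bool :=
  match s with vbot => \bot | vtop => \top end.

(* [infimum x0 A] is the greatest lower bound of A when A is nonempty and x0
   when A is empty, so the default vtop gives the meet of every subset. *)
Definition vmeet (A : set vstate) : vstate := infimum vtop A.

Lemma vmeet_glb (A : set vstate) : infimums A (vmeet A).
Proof.
rewrite /vmeet /infimum; case: ifPn => [/eqP ->|A0].
  by split=> [x []|y _]; case: y.
case: xgetP => [x _ //|noinf]; exfalso.
have [Abot|Abot] := pselect (A vbot).
  by apply: (noinf vbot); split=> [x _|y /(_ _ Abot) //]; case: x.
apply: (noinf vtop); split=> [x Ax|y _]; last by case: y.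
by case: x Ax => // /Abot.
Qed.

Definition ctx_bisim_map (P L : Type) (tr : P -> L -> P -> Prop)
    (m : P -> P -> vstate) : Prop :=
  forall p q : P,
    imm_dist tr p q <= vdown (m p q) /\
    forall (l : L) (s' : vstate), vtrans (m p q) l s' ->
      (forall p', tr p l p' -> exists q', tr q l q' /\ m p' q' <= s') /\
      (forall q', tr q l q' -> exists p', tr p l p' /\ m p' q' <= s').

Definition ctx_bisimilarity_map (P L : Type) (tr : P -> L -> P -> Prop)
    (p q : P) : vstate :=
  vmeet [set m p q | m in [set m | ctx_bisim_map tr m]].

Definition strong_bisimulation (P L : Type) (tr : P -> L -> P -> Prop)
    (R : P -> P -> Prop) : Prop :=
  forall p q : P, R p q -> forall l : L,
    (forall p', tr p l p' -> exists q', tr q l q' /\ R p' q') /\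
    (forall q', tr q l q' -> exists p', tr p l p' /\ R p' q').

Definition strong_bisimilar (P L : Type) (tr : P -> L -> P -> Prop)
    (p q : P) : Prop :=
  exists R : P -> P -> Prop, strong_bisimulation tr R /\ R p q.

Lemma strong_bisimilar_largest (P L : Type) (tr : P -> L -> P -> Prop) :
  strong_bisimulation tr (strong_bisimilar tr) /\
  forall R, strong_bisimulation tr R ->
    forall p q, R p q -> strong_bisimilar tr p q.
Proof.
split=> [p q [R [bR Rpq]] l|R bR p q Rpq]; last by exists R.
have [f b] := bR _ _ Rpq l; split=> [p' /f|q' /b] [x [tx Rx]];
  by exists x; split=> //; exists R.
Qed.

(* Main.v *)
Require Import Defs.
From mathcomp Require Import all_boot all_order.
From mathcomp Require Import boolp classical_sets.

(* A map m is a contextual bisimulation map exactly when its zero set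
   {m = vbot} is a strong bisimulation: vbot is the only state of the
   two-state system with transitions, and it only steps to itself, so the
   transfer conditions on m constrain nothing but the zero set, while
   [imm_dist tr p q = \bot] is implied by transfer. *)

Lemma vle_bot (s : vstate) : (s <= vbot)%O <-> s = vbot.
Proof. by case: s. Qed.

(** If [A] misses [vbot], then [vtop] is a lower bound, so the meet is [vtop]. Hence bisimilarity at
    [vbot] is witnessed by a single map. *)
Lemma vmeet_eq_bot (A : set vstate) : vmeet A = vbot <-> A vbot.
Proof.
have [lbA glbA] := vmeet_glb A; split=> [meet0|A0].
- apply: contrapT => nA0.
  suff /glbA : lbound A vtop by rewrite meet0.
  by case.
- by apply/vle_bot/lbA.
Qed.

Lemma ctx_bisim_mapP (P L : Type) (tr : P -> L -> P -> Prop)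
    (m : P -> P -> vstate) :
  ctx_bisim_map tr m <-> strong_bisimulation tr (fun p q => m p q = vbot).
Proof.
split=> [bm p q m0 l|bR p q].
- have [_ /(_ l vbot (conj m0 erefl)) [fwd bwd]] := bm p q.
  by split=> [p' /fwd|q' /bwd] [x [tx /vle_bot mx]]; exists x.
- split=> [|l s' [m0 ->]].
  (* At [vtop] the bound is trivial; at [vbot], transfer makes both states enable the same
     labels. *)
  + rewrite /imm_dist; case E: (m p q); last by case: ifP.
    rewrite asboolT // => l; have [fwd bwd] := bR _ _ E l.
    by split=> -[x] => [/fwd|/bwd] [y [ty _]]; exists y.
  + have [fwd bwd] := bR _ _ m0 l.
    by split=> [p' /fwd|q' /bwd] [x [tx /vle_bot mx]]; exists x.
Qed.

Theorem proposition4p1 (P L : Type) (tr : P -> L -> P -> Prop) (p q : P) :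
  ctx_bisimilarity_map tr p q = vbot <-> strong_bisimilar tr p q.
Proof.
rewrite /ctx_bisimilarity_map vmeet_eq_bot; split.
- move=> [m /ctx_bisim_mapP bm m0].
  by exists (fun x y => m x y = vbot).
- move=> [R [bR Rpq]].
  (* The characteristic map of [R], with [vbot] for membership, so that its zero set is [R]
     itself. *)
  exists (fun x y => if `[< R x y >] then vbot else vtop); last by rewrite asboolT.
  apply/ctx_bisim_mapP; congr strong_bisimulation: bR.
  apply/funext => x; apply/funext => y; apply/propext.
  by case: asboolP.
Qed.
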